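(* Let $F\colon S(n)\to\mathbb{R}$ be a rotationally invariant, sublinear and degenerate elliptic operator with $F\not\equiv 0$, and let $p\in[2,\infty]$ be the body cone aperture of its associated convex body. Then there exists a constant $c>0$ such that \[cF_p(X)\leq F(X)\qquad\text{for all }X\in S(n),\] where $F_p(X)=(p-2)\lambda_{\max}(X)+\operatorname{tr}X$ for $2\leq p<\infty$ and $F_\infty(X)=\lambda_{\max}(X)$.
   Context: Here $n\geq 2$ and $S(n)$ is the space of symmetric real $n\times n$ matrices with inner product $\langle X,Y\rangle=\operatorname{tr}(XY)$, partially ordered by $X\leq Y$ iff $\xi^TX\xi\leq\xi^TY\xi$ for all $\xi\in\mathbb{R}^n$; $\lambda_{\max}(X)$ is the largest eigenvalue of $X$. A function $F\colon S(n)\to\mathbb{R}$ is sublinear if $F(X+Y)\leq F(X)+F(Y)$ and $F(tX)=tF(X)$ for all $X,Y\in S(n)$, $t\geq 0$; degenerate elliptic if $X\leq Y$ implies $F(X)\leq F(Y)$; rotationally invariant if $F(QXQ^T)=F(X)$ for all $X\in S(n)$ and all orthogonal $n\times n$ matrices $Q$. The associated convex body of a sublinear $F$ is the unique nonempty compact convex set $\mathcal{K}=\mathcal{K}_F\subseteq S(n)$ such that $F(X)=\max_{Y\in\mathcal{K}}\langle Y,X\rangle$ for all $X$; explicitly $\mathcal{K}_F=\{Z\in S(n)\;|\;\langle Z,X\rangle\leq F(X)\ \forall X\in S(n)\}$. When $F$ is degenerate elliptic all matrices in $\mathcal{K}_F$ are positive semidefinite, and $F\not\equiv 0$ means $\mathcal{K}_F\neq\{0\}$.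 The solution cone aperture is \[\alpha=\alpha(\mathcal{K}):=\min_{Z\in\mathcal{K},\,Z\neq 0}\frac{\operatorname{tr}Z}{\lambda_{\max}(Z)}\in[1,n],\] where the minimum is understood to be attained at some nonzero $Z\in\mathcal{K}$. The body cone aperture is \[p=p(\mathcal{K}):=\begin{cases}\frac{n+\alpha-2}{\alpha-1},&1<\alpha\leq n,\\ \infty,&\alpha=1.\end{cases}\] *)

(* Defs.v *)
From mathcomp Require Import all_boot all_order all_algebra.
From mathcomp Require Import all_classical all_reals constructive_ereal.

Set Implicit Arguments.
Unset Strict Implicit.
Unset Printing Implicit Defensive.

Import Order.TTheory GRing.Theory Num.Theory.

Local Open Scope classical_set_scope.
Local Open Scope ring_scope.

Section Operators.
Context {R : realType} {n : nat}.
Implicit Types (X Y Z Q : 'M[R]_n) (K : set 'M[R]_n).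

(* S(n) is the set of X : 'M[R]_n with X \is symmetricmx.  An operator on S(n)
   is a function F on all of 'M[R]_n, of which only the values at symmetric
   matrices are ever used. *)
Implicit Type F : 'M[R]_n -> R.

Definition mxdot X Y : R := \tr (X *m Y).

Definition quad_form X (xi : 'cV[R]_n) : R := (xi^T *m X *m xi) 0 0.

Definition loewner_le X Y : Prop :=
  forall xi : 'cV[R]_n, quad_form X xi <= quad_form Y xi.

Definition orthogonal_mx Q : Prop := Q *m Q^T = 1%:M.

(* For symmetric X and 0 < n the set of real eigenvalues is finite and
   nonempty, so this supremum is the largest eigenvalue. *)
Definition lambda_max X : R := sup [set a : R | eigenvalue X a].

Definition sublinear F : Prop :=
  (forall X Y, X \is symmetricmx -> Y \is symmetricmx ->
     F (X + Y) <= F X + F Y) /\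
  (forall (t : R) X, 0 <= t -> X \is symmetricmx -> F (t *: X) = t * F X).

Definition degenerate_elliptic F : Prop :=
  forall X Y, X \is symmetricmx -> Y \is symmetricmx ->
    loewner_le X Y -> F X <= F Y.

Definition rotationally_invariant F : Prop :=
  forall X Q, X \is symmetricmx -> orthogonal_mx Q ->
    F (Q *m X *m Q^T) = F X.

(* For sublinear F this is the unique nonempty compact convex subset K of S(n)
   with F X = max over Y in K of mxdot Y X for all X in S(n). *)
Definition convex_body F : set 'M[R]_n :=
  [set Z | Z \is symmetricmx /\
           forall X, X \is symmetricmx -> mxdot Z X <= F X].

(* A relation rather than a function: the ratio is scale invariant, so when
   0 \in K its infimum over K minus 0 need not be attained even if K is compact,
   and the aperture is only defined when the minimum exists. *)
Definition solution_cone_aperture K (alpha : R) : Prop :=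
  (exists Z, [/\ K Z, Z != 0 & \tr Z / lambda_max Z = alpha]) /\
  (forall Z, K Z -> Z != 0 -> alpha <= \tr Z / lambda_max Z).

Definition body_cone_aperture K (p : \bar R) : Prop :=
  exists2 alpha : R, solution_cone_aperture K alpha &
    p = if alpha == 1 then +oo%E
        else ((n%:R + alpha - 2) / (alpha - 1))%:E.

(* Only used for 2 <= p <= +oo; the value at p = -oo is a dummy. *)
Definition dominative (p : \bar R) X : R :=
  match p with
  | r%:E => (r - 2) * lambda_max X + \tr X
  | +oo%E => lambda_max X
  | -oo%E => 0
  end.

End Operators.

(* Main.v *)
(* Let Z in the body attain the aperture alpha, and let m be its largest
   eigenvalue.  Rotational invariance makes the body stable under orthogonal
   conjugation, so Z may be taken diagonal in an eigenbasis of X, with m facing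
   the largest eigenvalue of X, and its other entries may be averaged over
   cyclic permutations.  Testing X against this average gives
     m (lambda_max X + (alpha - 1) / (n - 1) * (tr X - lambda_max X)) <= F X,
   whose left-hand side is a positive multiple of F_p X. *)
Require Import Defs.
From mathcomp Require Import all_boot all_order all_algebra.
From mathcomp Require Import all_classical all_reals constructive_ereal.
From mathcomp Require Import perm complex ring.

Set Implicit Arguments.
Unset Strict Implicit.
Unset Printing Implicit Defensive.

Import Order.TTheory GRing.Theory Num.Theory.

Local Open Scope ring_scope.

Section SymmetricMatrices.
Context {R : realType}.

(** * Orthogonal and symmetric matrices *)

Lemma orthogonal_mx_tr n (Q : 'M[R]_n) : orthogonal_mx Q -> orthogonal_mx Q^T.
Proof. by rewrite /orthogonal_mx trmxK; apply: mulmx1C. Qed.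

Lemma orthogonal_mxM n (P Q : 'M[R]_n) :
  orthogonal_mx P -> orthogonal_mx Q -> orthogonal_mx (P *m Q).
Proof.
move=> hP hQ; rewrite /orthogonal_mx trmx_mul mulmxA -(mulmxA P) hQ.
by rewrite mulmx1.
Qed.

Lemma symmetricmxP n (X : 'M[R]_n) : reflect (X^T = X) (X \is symmetricmx).
Proof.
apply: (iffP (is_hermitianmxP _ _ _)); rewrite expr0 scale1r map_mx_id //.
Qed.

Lemma symmetricmx_conj n (Q X : 'M[R]_n) :
  X \is symmetricmx -> Q *m X *m Q^T \is symmetricmx.
Proof.
by move=> /symmetricmxP hX; apply/symmetricmxP; rewrite !trmx_mul trmxK hX mulmxA.
Qed.

Lemma symmetricmx_diag n (d : 'rV[R]_n) : diag_mx d \is symmetricmx.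
Proof. by apply/symmetricmxP; rewrite tr_diag_mx. Qed.

(** * The spectral theorem over the reals *)

Lemma dot_gt0 n (v : 'rV[R]_n) : v != 0 -> 0 < (v *m v^T) 0 0.
Proof.
move=> v0; have h0 i : 0 <= v 0 i * v^T i 0 by rewrite mxE -expr2 sqr_ge0.
rewrite lt_neqAle mxE sumr_ge0 ?andbT; last by move=> i _; apply: h0.
apply: contra v0 => /eqP/esym/psumr_eq0P h; apply/eqP/rowP => i.
have /eqP := h (fun i _ => h0 i) i isT.
by rewrite !mxE mulf_eq0 orbb => /eqP.
Qed.

(* The Householder reflection exchanging v and the first basis vector. *)
Lemma orthogonal_row0 n (v : 'rV[R]_n.+1) : v *m v^T = 1%:M ->
  exists2 Q : 'M[R]_n.+1, orthogonal_mx Q & delta_mx 0 0 *m Q = v.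
Proof.
move=> v1; pose e : 'rV[R]_n.+1 := delta_mx 0 0; pose u := e - v.
have e1 : e *m e^T = 1%:M.
  by rewrite trmx_delta mul_delta_mx; apply/matrixP=> i j; rewrite !ord1 !mxE.
case: (eqVneq u 0) => [u0|u0].
  exists 1%:M; first by rewrite /orthogonal_mx trmx1 mulmx1.
  by rewrite mulmx1; apply/eqP; rewrite -subr_eq0 -/e -/u u0.
pose s := (u *m u^T) 0 0.
have s0 : s != 0 by rewrite gt_eqF ?dot_gt0.
have us : u *m u^T = s%:M by rewrite [LHS]mx11_scalar.
(* Since [e] and [v] are unit vectors, both sides equal 2 minus twice their inner product; this is
   why the reflection along [u] sends [e] to [v]. *)
have eu : 2 * (e *m u^T) 0 0 = s.
  have uT : u^T = e^T - v^T by rewrite /u linearB.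
  rewrite /s uT /u mulmxBl !mulmxBr e1 v1.
  have -> : v *m e^T = e *m v^T.
    by rewrite [LHS]mx11_scalar -[LHS]tr_scalar_mx -mx11_scalar trmx_mul trmxK.
  by rewrite !mxE /=; ring.
pose H := 1%:M - (2 / s) *: (u^T *m u).
have HT : H^T = H by rewrite /H raddfB /= linearZ /= trmx1 trmx_mul trmxK.
exists H; last first.
  rewrite mulmxBr mulmx1 -scalemxAr mulmxA -/e [e *m u^T]mx11_scalar.
  rewrite mul_scalar_mx scalerA mulrAC eu divff // scale1r.
  by rewrite /u opprB addrC subrK.
(* [H] is symmetric, so the claim is [H *m H = 1%:M]: the coefficient of [u^T *m u] is -4/s +
   (2/s)^2 s = 0. *)
rewrite /orthogonal_mx HT {2}/H mulmxBr mulmx1 -scalemxAr /H mulmxBl mul1mx.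
rewrite -scalemxAl mulmxA -[u^T *m u *m u^T]mulmxA us mul_mx_scalar -scalemxAl.
rewrite scalerBr !scalerA opprB addrA -addrA -[RHS]addr0 -addrA; congr (_ + _).
rewrite -!scaleNr -!scalerDl; apply/eqP; rewrite scaler_eq0; apply/orP; left.
by apply/eqP; field.
Qed.

(** The complexification of [X] is Hermitian, so its spectrum is real; a real scalar that is an
    eigenvalue over the complex numbers is already one over [R], and a real eigenvector is then
    normalised. *)
Lemma symmetric_eigenvector n (X : 'M[R]_n.+1) : X \is symmetricmx ->
  exists a : R, exists2 v : 'rV[R]_n.+1, v *m X = a *: v & v *m v^T = 1%:M.
Proof.
move=> /symmetricmxP hX; pose XC := map_mx (real_complex R) X.
have hXC : XC \is hermsymmx.
  apply: realsym_hermsym.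
    by apply/is_hermitianmxP; rewrite expr0 scale1r map_mx_id // /XC map_trmx hX.
  by apply/mxOverP => i j; rewrite mxE; apply/complex_realP; exists (X i j).
have /hermitian_normalmx/orthomx_spectralP := hXC.
set P := spectralmx XC; set d := spectral_diag XC => XCE.
have uP : P \in unitmx := spectral_unit XC.
have /mxOverP/(_ 0 0)/complex_realP[a da] := hermitian_spectral_diag_real hXC.
have : eigenvalue XC (real_complex R a).
  apply/eigenvalueP; exists (row 0 P).
    rewrite -row_mul XCE !mulmxA mulmxV // mul1mx; apply/rowP => j.
    by rewrite mul_diag_mx !mxE -da.
  apply/eqP => P0; have := row_mul 0 P (invmx P).
  rewrite P0 mul0mx mulmxV // => /rowP/(_ 0)/eqP.
  by rewrite !mxE eqxx oner_eq0.
rewrite eigenvalue_map => /eigenvalueP[w wX /dot_gt0 w0].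
set s := (w *m w^T) 0 0 in w0.
exists a, ((Num.sqrt s)^-1 *: w); first by rewrite -scalemxAl wX !scalerA mulrC.
rewrite linearZ /= -scalemxAl -scalemxAr scalerA [w *m _]mx11_scalar -/s.
rewrite -invfM -expr2 sqr_sqrtr ?ltW // -mul_scalar_mx -scalar_mxM.
by rewrite mulVf // gt_eqF.
Qed.

(** Deflation: rotating a unit eigenvector to the first basis vector splits off a block of size 1,
    and induction diagonalises the complementary block. *)
Lemma real_spectral n (X : 'M[R]_n) : X \is symmetricmx ->
  exists Q d, orthogonal_mx Q /\ Q *m X *m Q^T = diag_mx d.
Proof.
elim: n => [|n IH] in X *; first by exists 1%:M, 0; rewrite /orthogonal_mx !thinmx0.
move=> hX; have [a [v vX /orthogonal_row0[H hH Hv]]] := symmetric_eigenvector hX.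
have [Y YH] : exists Y, Y = H *m X *m H^T by exists (H *m X *m H^T).
have hY : Y^T = Y by apply/symmetricmxP; rewrite YH symmetricmx_conj.
have Y0 : delta_mx 0 0 *m Y = a *: delta_mx 0 0 :> 'rV_n.+1.
  by rewrite YH !mulmxA Hv vX -scalemxAl -Hv -mulmxA hH mulmx1.
pose D : 'M_n := drsubmx (Y : 'M_(1 + n)).
have Y0j j : Y 0 j = a *+ (j == 0).
  by have /rowP/(_ j) := Y0; rewrite -rowE !mxE mulr_natr.
have Yur : ursubmx (Y : 'M_(1 + n)) = 0.
  apply/matrixP=> i j; rewrite ord1 !mxE.
  have -> : lshift n (0 : 'I_1) = 0 by apply/val_inj.
  exact: Y0j.
have Yul : ulsubmx (Y : 'M_(1 + n)) = a%:M.
  apply/matrixP=> i j; rewrite !ord1 !mxE.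
  have -> : lshift n (0 : 'I_1) = 0 by apply/val_inj.
  exact: Y0j.
have Ydl : dlsubmx (Y : 'M_(1 + n)) = 0.
  by rewrite -[X in dlsubmx X]hY -trmx_ursub Yur trmx0.
have YE : Y = block_mx (a%:M : 'M_1) 0 0 D.
  by rewrite -[LHS](@submxK _ 1 n 1 n) Yul Yur Ydl.
have hD : D \is symmetricmx.
  by apply/symmetricmxP; rewrite /D trmx_drsub hY.
have [Q [d [hQ QD]]] := IH _ hD.
pose P : 'M_n.+1 := block_mx (1%:M : 'M_1) 0 0 Q.
have PT : P^T = block_mx (1%:M : 'M_1) 0 0 Q^T.
  by rewrite /P (@tr_block_mx _ 1 n 1 n) !trmx0 trmx1.
exists (P *m H), (row_mx a%:M d); split.
  apply: orthogonal_mxM hH; rewrite /orthogonal_mx PT /P.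
  rewrite (@mulmx_block _ 1 n 1 n 1 n) !(mulmx0, mul0mx, addr0, add0r, mulmx1) hQ.
  exact/esym/(@scalar_mx_block _ 1 n).
rewrite trmx_mul -!mulmxA (mulmxA X) (mulmxA H) (mulmxA H) -YH PT YE /P.
rewrite !(@mulmx_block _ 1 n 1 n 1 n) !(mulmx0, mul0mx, addr0, add0r, mulmx1, mul1mx).
rewrite mulmxA QD; rewrite -[RHS]/(diag_mx (row_mx (a%:M : 'M_1) d : 'rV_(1 + n))).
rewrite diag_mx_row.
suff -> : diag_mx (a%:M : 'M_1) = a%:M by [].
by apply/matrixP=> i j; rewrite !ord1 !mxE.
Qed.

Lemma orthogonal_perm_mx n (s : 'S_n) : orthogonal_mx (perm_mx s : 'M[R]_n).
Proof. by rewrite /orthogonal_mx tr_perm_mx -perm_mxM mulgV perm_mx1. Qed.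

Lemma perm_mx_conj_diag n (s : 'S_n) (d : 'rV[R]_n) :
  perm_mx s *m diag_mx d *m (perm_mx s)^T = diag_mx (col_perm s d).
Proof.
rewrite tr_perm_mx -row_permE -col_permE.
by apply/matrixP => i j; rewrite !mxE (inj_eq perm_inj).
Qed.

(** Applied to two matrices, this normal form makes their largest eigenvalues face each other at
    index 0. *)
Lemma real_spectral_max0 n (X : 'M[R]_n.+1) : X \is symmetricmx ->
  exists Q d, [/\ orthogonal_mx Q, Q *m X *m Q^T = diag_mx d &
                  forall i, d 0 i <= d 0 0].
Proof.
move=> /real_spectral[Q [d [hQ QX]]].
have [j _ hj] := arg_maxP (d 0) (erefl : xpredT (0 : 'I_n.+1)).
pose s := tperm 0 j.
exists (perm_mx s *m Q), (col_perm s d); split.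
- exact: orthogonal_mxM (orthogonal_perm_mx s) hQ.
- by rewrite trmx_mul -!mulmxA (mulmxA X) (mulmxA Q) (mulmxA Q) QX mulmxA
    perm_mx_conj_diag.
- by move=> i; rewrite !mxE tpermL; apply: hj.
Qed.

(** * Eigenvalues and trace in a diagonalising frame *)

Lemma eigenvalue_orthogonal_diag n (Q X : 'M[R]_n) (d : 'rV[R]_n) (a : R) :
  orthogonal_mx Q -> Q *m X *m Q^T = diag_mx d ->
  eigenvalue X a <-> exists i, a = d 0 i.
Proof.
move=> hQ QX; have hQT : Q^T *m Q = 1%:M by apply: mulmx1C.
have QX' : Q *m X = diag_mx d *m Q by rewrite -QX -mulmxA hQT mulmx1.
split=> [/eigenvalueP[v vX v0]|[i ->]].
  have vQ0 : v *m Q^T != 0.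
    apply: contra v0 => /eqP vQ.
    by rewrite -[v]mulmx1 -hQT mulmxA vQ mul0mx.
  have /eqP : v *m Q^T *m diag_mx d = a *: (v *m Q^T).
    by rewrite -QX !mulmxA -(mulmxA v) hQT mulmx1 vX scalemxAl.
  have /rV0Pn[i wi] := vQ0.
  move=> /eqP/rowP/(_ i); rewrite mul_mx_diag !mxE mulrC => /mulIf h.
  by exists i; rewrite h //; move: wi; rewrite mxE.
apply/eigenvalueP; exists (row i Q).
  by rewrite -row_mul QX'; apply/rowP => j; rewrite mul_diag_mx !mxE.
apply/eqP => Q0; have := row_mul i Q Q^T; rewrite Q0 mul0mx hQ.
by move=> /rowP/(_ i)/eqP; rewrite !mxE eqxx oner_eq0.
Qed.

Lemma lambda_max_orthogonal_diag n (Q X : 'M[R]_n) (d : 'rV[R]_n) i0 :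
  orthogonal_mx Q -> Q *m X *m Q^T = diag_mx d ->
  (forall i, d 0 i <= d 0 i0) -> lambda_max X = d 0 i0.
Proof.
move=> hQ QX hd; have evP a := eigenvalue_orthogonal_diag a hQ QX.
have ub : ubound [set a | eigenvalue X a]%classic (d 0 i0).
  by move=> a /evP[i ->].
have mem : [set a | eigenvalue X a]%classic (d 0 i0) by apply/evP; exists i0.
apply/eqP; rewrite eq_le; apply/andP; split.
  by apply: ge_sup => //; exists (d 0 i0).
by apply: ub_le_sup => //; exists (d 0 i0).
Qed.

Lemma mxtrace_conj n (Q X : 'M[R]_n) :
  orthogonal_mx Q -> \tr (Q *m X *m Q^T) = \tr X.
Proof. by move=> hQ; rewrite mxtrace_mulC mulmxA (mulmx1C hQ) mul1mx. Qed.

(** * Symmetry and positivity of the convex body *)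

(** By cyclicity of the trace the conjugation moves from [Z] to the test matrix, where [F] does not
    see it. *)
Lemma convex_body_conj n (F : 'M[R]_n -> R) (Q Z : 'M[R]_n) :
  rotationally_invariant F -> orthogonal_mx Q ->
  convex_body F Z -> convex_body F (Q *m Z *m Q^T).
Proof.
move=> Frot hQ [hZ ZF]; split=> [|X hX]; first exact: symmetricmx_conj.
have /ZF := symmetricmx_conj Q^T hX.
rewrite (Frot _ _ hX (orthogonal_mx_tr hQ)) trmxK; apply: le_trans.
by rewrite /mxdot -!mulmxA mxtrace_mulC !mulmxA.
Qed.

Lemma mxdot_diag n (z x : 'rV[R]_n) :
  mxdot (diag_mx z) (diag_mx x) = \sum_i z 0 i * x 0 i.
Proof.
by rewrite /mxdot mulmx_diag mxtrace_diag; apply: eq_bigr => i _; rewrite mxE.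
Qed.

(** The test matrix with sole nonzero entry -1 at place [i] of the diagonal lies below 0, so [F] is
    at most [F 0 = 0] there, while its pairing with [diag_mx z] is [- z 0 i]. *)
Lemma convex_body_diag_ge0 n (F : 'M[R]_n -> R) (z : 'rV[R]_n) :
  sublinear F -> degenerate_elliptic F -> convex_body F (diag_mx z) ->
  forall i, 0 <= z 0 i.
Proof.
move=> [_ Fhom] Fell [_ zF] i; pose e : 'rV[R]_n := - delta_mx 0 i.
have sym0 : (0 : 'M[R]_n) \is symmetricmx.
  by apply/symmetricmxP; rewrite trmx0.
have F0 : F 0 = 0 by rewrite -(scale0r 0) Fhom ?mul0r.
have e0 : F (diag_mx e) <= 0.
  rewrite -F0; apply: Fell; rewrite ?symmetricmx_diag //.
  move=> xi; rewrite /quad_form mulmx0 mul0mx [leRHS]mxE mul_mx_diag mxE.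
  apply: sumr_le0 => j _; rewrite !mxE.
  by rewrite mulrN mulNr mulrAC -expr2 oppr_le0 mulr_ge0 ?sqr_ge0.
have := le_trans (zF _ (symmetricmx_diag e)) e0; rewrite mxdot_diag.
rewrite (bigD1 i) //= big1 => [|j ji].
  by rewrite !mxE !eqxx mulrN1 addr0 oppr_le0.
by rewrite !mxE (negPf ji) andbF oppr0 mulr0.
Qed.

(* Averaging z over the cyclic shifts of the last coordinates replaces each of
   them by their mean. *)
Lemma convex_body_diag_average n (F : 'M[R]_n.+2 -> R) (z x : 'rV[R]_n.+2) :
  rotationally_invariant F -> convex_body F (diag_mx z) ->
  z 0 0 * x 0 0 + (\tr (diag_mx z) - z 0 0) * (\tr (diag_mx x) - x 0 0) / n.+1%:R
  <= F (diag_mx x).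
Proof.
move=> Frot zK.
(* [sh k] fixes index 0 and adds [k] modulo [n.+1] to the position among the others. *)
pose sh (k : 'I_n.+1) : 'S_n.+2 := lift0_perm (perm (addIr k)).
have le_sh k : \sum_i z 0 (sh k i) * x 0 i <= F (diag_mx x).
  have [_ /(_ _ (symmetricmx_diag x))] :=
    convex_body_conj Frot (orthogonal_perm_mx (sh k)) zK.
  by rewrite perm_mx_conj_diag mxdot_diag; under eq_bigr do rewrite mxE.
have : \sum_k \sum_i z 0 (sh k i) * x 0 i <= \sum_(k < n.+1) F (diag_mx x).
  by apply: ler_sum => k _; apply: le_sh.
rewrite sumr_const card_ord.
(* For a fixed nonzero index, its images under the shifts run once through all nonzero indices, so
   the tail of the double sum factors. *)
have -> : \sum_k \sum_i z 0 (sh k i) * x 0 i =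
  n.+1%:R * (z 0 0 * x 0 0) +
  (\sum_i z 0 (lift 0 i)) * \sum_i x 0 (lift 0 i).
  under eq_bigr do rewrite big_ord_recl lift0_perm0.
  rewrite big_split /= sumr_const card_ord mulr_natl; congr (_ + _).
  under eq_bigr do under eq_bigr do rewrite lift0_perm_lift permE.
  rewrite exchange_big /= mulr_sumr; apply: eq_bigr => i _.
  rewrite -mulr_suml; congr (_ * _).
  by rewrite [RHS](reindex_inj (addrI i)).
rewrite !mxtrace_diag !(big_ord_recl n.+1) /= ![_ + _ - _]addrAC !subrr !add0r.
rewrite -[leRHS]mulr_natl -ler_pdivrMl ?ltr0n // mulrDr mulKf ?pnatr_eq0 //.
by rewrite [_^-1 * _]mulrC.
Qed.
End SymmetricMatrices.

Theorem theorem3p3p1 (R : realType) (n : nat) (hn : (2 <= n)%N)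
    (F : 'M[R]_n -> R)
    (Frot : rotationally_invariant F)
    (Fsub : sublinear F)
    (Fell : degenerate_elliptic F)
    (Fn0 : exists2 X, X \is symmetricmx & F X != 0)
    (p : \bar R) (hp : body_cone_aperture (convex_body F) p) :
  exists2 c : R, 0 < c &
    forall X : 'M[R]_n, X \is symmetricmx -> c * dominative p X <= F X.
Proof.
(* From here on the dimension is [n.+2], and [n.+1] counts the diagonal entries other than the
   first. *)
case: n hn F Frot Fsub Fell Fn0 hp => [//|[//|n]] _ F Frot Fsub Fell _.
case=> alpha [[Z [ZK Z0 Zalpha]] _] hp.
have [P [z [hP PZ zmax]]] := real_spectral_max0 ZK.1.
have zK : convex_body F (diag_mx z) by rewrite -PZ; apply: convex_body_conj.
have z_ge0 := convex_body_diag_ge0 Fsub Fell zK.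
have trZ : \tr Z = \tr (diag_mx z) by rewrite -PZ mxtrace_conj.
have lZ : lambda_max Z = z 0 0 := lambda_max_orthogonal_diag hP PZ zmax.
(* The entries of [z] lie between 0 and [z 0 0], so [z 0 0 = 0] would force [Z = 0]. *)
have z00 : 0 < z 0 0.
  rewrite lt_neqAle z_ge0 andbT eq_sym; apply: contra Z0 => /eqP z00.
  have d0 : diag_mx z = 0.
    suff -> : z = 0 by rewrite linear0.
    by apply/rowP => i; apply/eqP; rewrite !mxE eq_le z_ge0 -{1}z00 zmax.
  have -> : Z = P^T *m diag_mx z *m P.
    by rewrite -PZ !mulmxA (mulmx1C hP) mul1mx -mulmxA (mulmx1C hP) mulmx1.
  by rewrite d0 mulmx0 mul0mx.
have {}trZ : \tr (diag_mx z) = alpha * z 0 0.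
  by rewrite -Zalpha lZ trZ divfK // gt_eqF.
have alpha1 : 1 <= alpha.
  rewrite -(ler_pM2r z00) mul1r -trZ mxtrace_diag (bigD1 0) //= lerDl.
  by rewrite sumr_ge0.
have key X : X \is symmetricmx ->
    z 0 0 * (lambda_max X + (alpha - 1) * (\tr X - lambda_max X) / n.+1%:R)
    <= F X.
  move=> hX; have [Q [x [hQ QX xmax]]] := real_spectral_max0 hX.
  rewrite (lambda_max_orthogonal_diag hQ QX xmax) -(mxtrace_conj X hQ) QX.
  rewrite -(Frot _ _ hX hQ) QX.
  apply: le_trans (convex_body_diag_average x Frot zK); rewrite trZ.
  by rewrite le_eqVlt; apply/orP; left; apply/eqP; ring.
move: hp; case: eqVneq => [a1|alpha_neq1] ->.
  (* For [alpha = 1] the trace term of [key] vanishes, leaving a multiple of [lambda_max X]. *)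
  by exists (z 0 0) => // X /key; rewrite a1 subrr !mul0r addr0.
have a1 : 0 < alpha - 1 by rewrite subr_gt0 lt_neqAle eq_sym alpha_neq1.
(* This is the coefficient of [\tr X] in [key]. With N the dimension, p - 2 = (N - alpha) / (alpha -
   1), so the coefficients of [lambda_max X] agree as well. *)
exists (z 0 0 * (alpha - 1) / n.+1%:R) => [|X /key].
  by rewrite !mulr_gt0 ?invr_gt0 ?ltr0n.
apply: le_trans; rewrite le_eqVlt; apply/orP; left; apply/eqP => /=.
rewrite (_ : n.+2%:R = n.+1%:R + 1 :> R) ?natr1 //; field.
by rewrite nat1r pnatr_eq0 (gt_eqF a1).
Qed.
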